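(* Let $\Bbbk$ be any field and let $f:\mathbb{N}\to\mathbb{Z}_{\ge 0}$ be a convergent function, i.e. there is $t_0$ with $f(t)=f(t_0)$ for all $t\ge t_0$. Then there exist a polynomial ring $S$ over $\Bbbk$ and a monomial ideal $Q\subseteq S$ such that $\operatorname{depth} S/Q^t=f(t)$ for all $t\ge 1$.
   Context: For a homogeneous ideal $Q$ in a polynomial ring $S$ over a field, $\operatorname{depth} S/Q^t$ denotes the depth of $S/Q^t$ with respect to the maximal homogeneous ideal of $S$. Here $\mathbb{N}=\{1,2,3,\dots\}$. *)

(* Defs.v *)
From HB Require Import structures.
From mathcomp Require Import all_boot all_algebra.
From mathcomp Require Import mpoly.
From Stdlib Require Lists.List.
Set Implicit Arguments. Unset Strict Implicit. Unset Printing Implicit Defensive.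
Import GRing.Theory.
Local Open Scope ring_scope.

Section Defs.
Variables (k : fieldType) (n : nat).
Notation S := {mpoly k[n]}.

Definition ideal_gen (G : S -> Prop) : S -> Prop :=
  fun p => exists s : seq (S * S),
    (forall x, Stdlib.Lists.List.In x s -> G x.2) /\ p = \sum_(x <- s) x.1 * x.2.

Definition monomial_ideal (ms : seq 'X_{1..n}) : S -> Prop :=
  ideal_gen (fun p => exists2 m, m \in ms & p = 'X_[m]).

Definition ideal_pow (I : S -> Prop) (t : nat) : S -> Prop :=
  ideal_gen (fun p => exists qs : seq S,
    [/\ size qs = t, (forall q, Stdlib.Lists.List.In q qs -> I q) & p = \prod_(q <- qs) q]).

Definition in_max_ideal (p : S) : Prop := p@_0%MM = 0.

Definition ideal_add_seq (I : S -> Prop) (xs : seq S) : S -> Prop :=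
  ideal_gen (fun p => I p \/ Stdlib.Lists.List.In p xs).

Definition regular_seq (I : S -> Prop) (xs : seq S) : Prop :=
  [/\ forall x, Stdlib.Lists.List.In x xs -> in_max_ideal x,
      forall i, (i < size xs)%N -> forall p : S,
        ideal_add_seq I (take i xs) (nth 0 xs i * p) ->
        ideal_add_seq I (take i xs) p
    & ~ ideal_add_seq I xs 1].

Definition depth_eq (I : S -> Prop) (d : nat) : Prop :=
  (exists xs, size xs = d /\ regular_seq I xs) /\
  (forall xs, regular_seq I xs -> (size xs <= d)%N).

End Defs.

(* Main.v *)
(** The depth of a product of monomial ideals sharing one variable is additive:
    if J_1, ..., J_r are monomial ideals in k[w, x_1], ..., k[w, x_r], where the
    x_j are disjoint groups of variables, then whether a monomial lies in
    Q = w J_1 ... J_r only depends on how the exponent of w can be distributed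
    among the factors, and depth S/Q^t is the sum of the depths of the
    k[w, x_j]/J_j^t.  As f is a sum of functions that are 1 at one d and 0
    elsewhere, plus f(t0) copies of the indicator function of t >= t0, two kinds
    of blocks suffice.

    A block is J = I K in k[w, v, y, y'].  The powers I^t have a socle for t < d
    and become (w, v)^((d+2)t) for t >= d.  For one kind of blocks, the powers
    K^t have a socle for t > d, and K^d is the intersection of the d-th powers of
    (w^(d+1), y') and (w^(d+1), w y^(d-1), y^d); the first does not involve y
    and the second does not involve y', so that y - y' is regular, and putting
    y' = y leaves a monomial ideal with a socle.  For the other kind,
    K = (w, y y') and y - y' stays regular for all t.

    The differences y_j - y'_j of the blocks of depth 1 thus form a regular
    sequence modulo Q^t with a socle in the quotient, and Koszul cohomology
    shows that no regular sequence is longer. *)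

Require Import Defs.
From mathcomp Require Import all_boot all_algebra.
From mathcomp Require Import mpoly ring zify.
Set Implicit Arguments. Unset Strict Implicit. Unset Printing Implicit Defensive.
Import GRing.Theory.
Local Open Scope ring_scope.

(** * Koszul cohomology modulo an ideal and lengths of regular sequences *)

Section Koszul.
Variable R : comNzRingType.
Implicit Types (I J : R -> Prop) (x : R) (xs gs : seq R).
Implicit Types (c : seq bool -> R) (s : seq bool).

Definition is_ideal I :=
  [/\ I 0, forall a b, I a -> I b -> I (a + b) & forall r a, I a -> I (r * a)].

Lemma idealN I a : is_ideal I -> I a -> I (- a).
Proof. by case=> _ _ hM ha; rewrite -mulN1r; apply: hM. Qed.

Lemma idealB I a b : is_ideal I -> I a -> I b -> I (a - b).
Proof. by move=> hI ha hb; case: (hI) => _ hD _; apply: hD => //; apply: idealN. Qed.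

Lemma ideal_sub I a b : is_ideal I -> I (a - b) -> I b -> I a.
Proof. by move=> [_ hD _] hab hb; rewrite -(subrK b a); apply: hD. Qed.

Definition adjoin I x : R -> Prop := fun p => exists e, I (p - x * e).

Lemma adjoin_ideal I x : is_ideal I -> is_ideal (adjoin I x).
Proof.
move=> [h0 hD hM]; split.
- by exists 0; rewrite mulr0 subr0.
- move=> a b [e he] [g hg]; exists (e + g).
  have -> : a + b - x * (e + g) = (a - x * e) + (b - x * g) by ring.
  exact: hD.
- move=> r a [e he]; exists (r * e).
  have -> : r * a - x * (r * e) = r * (a - x * e) by ring.
  exact: hM.
Qed.

Definition regular_on I x := forall p, I (x * p) -> I p.

(* The Koszul cocomplex on [xs]: the basis vector e_{i1} /\ ... /\ e_{ik} is
   the bit sequence with ones at i1, ..., ik, and the complex on [x :: xs] is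
   the mapping cone of [x] on the one on [xs], which takes care of the signs. *)
Fixpoint kd xs c s : R :=
  match xs, s with
  | x :: xs', b :: s' =>
      if b then x * c (false :: s') - kd xs' (fun u => c (true :: u)) s'
      else kd xs' (fun u => c (false :: u)) s'
  | _, _ => 0
  end.

(* A contracting homotopy for the multiplication by \sum_i gs_i * xs_i. *)
Fixpoint kh gs c s : R :=
  match gs, s with
  | g :: gs', b :: s' =>
      if b then - kh gs' (fun u => c (true :: u)) s'
      else g * c (true :: s') + kh gs' (fun u => c (false :: u)) s'
  | _, _ => 0
  end.

Lemma kd_lin xs (a a' : R) c c' s :
  kd xs (fun u => a * c u + a' * c' u) s = a * kd xs c s + a' * kd xs c' s.
Proof.
elim: xs c c' s => [|x xs IH] c c' [|[] s] //=; rewrite ?mulr0 ?addr0 //.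
by rewrite (IH (fun u => c (true :: u)) (fun u => c' (true :: u))); ring.
Qed.

Lemma kh_lin gs (a a' : R) c c' s :
  kh gs (fun u => a * c u + a' * c' u) s = a * kh gs c s + a' * kh gs c' s.
Proof.
elim: gs c c' s => [|x xs IH] c c' [|[] s] //=; rewrite ?mulr0 ?addr0 //.
  by rewrite (IH (fun u => c (true :: u)) (fun u => c' (true :: u))); ring.
by rewrite (IH (fun u => c (false :: u)) (fun u => c' (false :: u))); ring.
Qed.

Lemma kd_ext xs c c' s : c =1 c' -> kd xs c s = kd xs c' s.
Proof.
elim: xs c c' s => [|x xs IH] c c' [|[] s] //= ecc'.
  by rewrite ecc' (IH _ (fun u => c' (true :: u))).
by rewrite (IH _ (fun u => c' (false :: u))).
Qed.

Lemma kh_ext gs c c' s : c =1 c' -> kh gs c s = kh gs c' s.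
Proof.
elim: gs c c' s => [|x xs IH] c c' [|[] s] //= ecc'.
  by rewrite (IH _ (fun u => c' (true :: u))).
by rewrite ecc' (IH _ (fun u => c' (false :: u))).
Qed.

Lemma kdB xs c c' s : kd xs (fun u => c u - c' u) s = kd xs c s - kd xs c' s.
Proof.
rewrite (@kd_ext _ _ (fun u => 1 * c u + (-1) * c' u)) ?kd_lin ?mul1r ?mulN1r //.
by move=> u; rewrite mul1r mulN1r.
Qed.

Lemma kdZ xs a c s : kd xs (fun u => a * c u) s = a * kd xs c s.
Proof.
rewrite (@kd_ext _ _ (fun u => a * c u + 0 * c u)) ?kd_lin ?mul0r ?addr0 //.
by move=> u; rewrite mul0r addr0.
Qed.

Lemma kd0 xs s : kd xs (fun=> 0) s = 0.
Proof. by rewrite -[RHS](mul0r (kd xs (fun=> 0) s)) -kdZ; apply: kd_ext => u; rewrite mul0r. Qed.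

Lemma kd_kd xs c s : kd xs (kd xs c) s = 0.
Proof.
elim: xs c s => [|x xs IH] c [|[] s] //=.
by rewrite kdB IH subr0 kdZ subrr.
Qed.

(** Along the mapping cone the cross terms of [x] and [g] cancel, leaving [g * x] from the first
    coordinate. *)
Lemma kd_kh gs xs c s : size gs = size xs -> size s = size xs ->
  kd xs (kh gs c) s + kh gs (kd xs c) s
  = (\sum_(gx <- zip gs xs) gx.1 * gx.2) * c s.
Proof.
elim: xs gs c s => [|x xs IH] [|g gs] c [|b s] //=.
  by rewrite big_nil mul0r addr0.
move=> [sg] [ss]; rewrite big_cons mulrDl /=.
case: b.
  rewrite -(IH gs (fun u => c (true :: u)) s sg ss).
  rewrite (@kd_ext _ (fun u => - kh gs (fun v => c (true :: v)) u)
     (fun u => (-1) * kh gs (fun v => c (true :: v)) u)); last first.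
    by move=> u; rewrite mulN1r.
  rewrite (@kh_ext _ (fun u => x * c (false :: u) - kd xs (fun v => c (true :: v)) u)
     (fun u => x * c (false :: u) + (-1) * kd xs (fun v => c (true :: v)) u)); last first.
    by move=> u; rewrite mulN1r.
  by rewrite kdZ kh_lin; ring.
rewrite -(IH gs (fun u => c (false :: u)) s sg ss).
rewrite (@kd_ext _ _ (fun u => g * c (true :: u) + 1 * kh gs (fun v => c (false :: v)) u)); last first.
  by move=> u; rewrite mul1r.
by rewrite kd_lin; ring.
Qed.

Lemma kd_ideal I xs c s : is_ideal I -> (forall s, size s = size xs -> I (c s)) ->
  size s = size xs -> I (kd xs c s).
Proof.
move=> hI; case: (hI) => h0 _ hM; elim: xs c s => [|x xs IH] c [|b s] //= hc [ss].
case: b; last by apply: IH => // u su; apply: hc; rewrite /= su.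
apply: idealB => //; first by apply: hM; apply: hc; rewrite /= ss.
by apply: IH => // u su; apply: hc; rewrite /= su.
Qed.

Lemma kh_ideal I gs c s : is_ideal I -> (forall s, size s = size gs -> I (c s)) ->
  size s = size gs -> I (kh gs c s).
Proof.
move=> hI; case: (hI) => h0 hD hM; elim: gs c s => [|x xs IH] c [|b s] //= hc [ss].
case: b.
  by apply: idealN => //; apply: IH => // u su; apply: hc; rewrite /= su.
apply: hD; first by apply: hM; apply: hc; rewrite /= ss.
by apply: IH => // u su; apply: hc; rewrite /= su.
Qed.

Lemma kd_socle I xs c s : is_ideal I -> (forall x s, x \in xs -> I (x * c s)) ->
  I (kd xs c s).
Proof.
move=> hI; case: (hI) => h0 _ _; elim: xs c s => [|x xs IH] c [|[] s] //= hc.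
  apply: idealB => //; first by apply: hc; rewrite mem_head.
  by apply: IH => // y u hy; apply: hc; rewrite inE hy orbT.
by apply: IH => // y u hy; apply: hc; rewrite inE hy orbT.
Qed.

Definition kdeg i c := forall s, count id s != i -> c s = 0.
(** Degree i - 1, phrased with a successor so that [i = 0] forces [c] to vanish. *)
Definition kdegS i c := forall s, (count id s).+1 != i -> c s = 0.

Lemma kd_deg i xs c : kdegS i c -> kdeg i (kd xs c).
Proof.
move=> hc s; elim: xs i c s hc => [|x xs IH] i c [|[] s] //= hc hs.
  rewrite hc ?mulr0 ?sub0r //.
  case: i hc hs => [|i] hc hs.
    by rewrite (@kd_ext _ _ (fun=> 0)) ?kd0 ?oppr0 // => u; apply: hc.
  by rewrite (IH i) ?oppr0 // => u hu; apply: hc.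
by apply: (IH i) => // u hu; apply: hc.
Qed.

Lemma kh_deg i gs c : kdeg i c -> kdegS i (kh gs c).
Proof.
move=> hc s; elim: gs i c s hc => [|x xs IH] i c [|[] s] //= hc hs.
  case: i hc hs => [|i] hc hs.
    rewrite (@kh_ext _ _ (fun u => 0 * c u + 0 * c u)) ?kh_lin ?mul0r ?add0r ?oppr0 // => u.
    by rewrite hc // !mul0r addr0.
  by rewrite (IH i) ?oppr0 // => u hu; apply: hc.
by rewrite hc ?mulr0 ?add0r // (IH i) // => u hu; apply: hc.
Qed.

(** Vanishing of the i-th Koszul cohomology of R/I on [xs], with cochains lifted to [R]. *)
Definition koszul_vanish xs I i := forall c, kdeg i c ->
  (forall s, size s = size xs -> I (kd xs c s)) ->
  exists2 b, kdegS i b & forall s, size s = size xs -> I (c s - kd xs b s).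

Lemma bitseq_choice (m : nat) (P : seq bool -> R -> Prop) :
  (forall s, size s = m -> exists e, P s e) ->
  exists e, forall s, size s = m -> P s (e s).
Proof.
move=> h; have [e he] : exists e : m.-tuple bool -> R, forall s : m.-tuple bool, P s (e s).
  by apply: (@fin_all_exists _ _ (fun s : m.-tuple bool => P s)) => s; apply: h; rewrite size_tuple.
exists (fun s => if insub s is Some u then e u else 0) => s /eqP ss.
by case: insubP => [u _ <-|/negP[]]; first exact: he.
Qed.

Definition in_span xs x :=
  exists2 gs, size gs = size xs & x = \sum_(gx <- zip gs xs) gx.1 * gx.2.

Section Step.
Variables (xs : seq R) (I : R -> Prop) (x : R).
Hypotheses (hI : is_ideal I) (xm : in_span xs x) (xreg : regular_on I x).

(** By the homotopy [kh], elements of the span of [xs] annihilate the cohomology. *)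
Lemma koszul_kill i c : kdeg i c -> (forall s, size s = size xs -> I (kd xs c s)) ->
  exists2 b, kdegS i b & forall s, size s = size xs -> I (x * c s - kd xs b s).
Proof.
move=> hc hd; case: xm => gs sg ->; exists (kh gs c); first exact: kh_deg.
move=> s ss; rewrite -kd_kh // addrC addKr; apply: kh_ideal; rewrite ?sg //.
Qed.

Lemma koszul_vanish0 : koszul_vanish xs I 0.
Proof.
move=> c hc hd; exists (fun=> 0) => // s ss; rewrite kd0 subr0; apply: xreg.
have [b hb] := koszul_kill hc hd; move=> /(_ s ss).
by rewrite (@kd_ext _ _ (fun=> 0)) ?kd0 ?subr0 // => u; apply: hb.
Qed.

(** For a cocycle c, x c = d b modulo I, so b is a cocycle modulo I + (x) and b = d b' + x e. Hence
    x (c - d e) lies in I, and x can be cancelled. *)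
Lemma koszul_vanishS i : koszul_vanish xs (adjoin I x) i -> koszul_vanish xs I i.+1.
Proof.
move=> hJ c hc hd; have [b hb hxb] := koszul_kill hc hd.
have [h0 hD hM] := hI.
have [|u hs|b' hb' hbb'] := hJ b; first by move=> s hs; apply: hb.
  exists (c u); rewrite -opprB; apply: idealN => //; exact: hxb.
have [e he] := bitseq_choice hbb'.
(* The chosen [e] need not be homogeneous; its other degrees can be discarded because b and d b'
   vanish there. *)
pose e' s := if count id s == i then e s else 0.
exists e'; first by move=> s hs; rewrite /e' ifN.
have he' s : size s = size xs -> I (b s - kd xs b' s - x * e' s).
  move=> ss; rewrite /e'; case: ifPn => hsi; first exact: he.
  by rewrite (hb _ hsi) (kd_deg xs hb' hsi) mulr0 !subr0.
move=> s ss; apply: xreg; rewrite mulrBr.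
have -> : x * c s - x * kd xs e' s
   = (x * c s - kd xs b s) + (kd xs b s - x * kd xs e' s) by ring.
apply: hD; first exact: hxb.
have := kd_ideal hI he' ss.
by rewrite !kdB kd_kd subr0 kdZ.
Qed.

(** The other piece of the long exact sequence: if d c = x e modulo I then e is a cocycle, x being
    regular, so e = d b; then c - x b is a cocycle modulo I, hence a coboundary. *)
Lemma koszul_vanish_adjoin i : koszul_vanish xs I i -> koszul_vanish xs I i.+1 ->
  koszul_vanish xs (adjoin I x) i.
Proof.
move=> hi hi1 c hc hd; have [h0 hD hM] := hI.
have [e he] := bitseq_choice hd.
pose e' s := if count id s == i.+1 then e s else 0.
have he' s : size s = size xs -> I (kd xs c s - x * e' s).
  move=> ss; rewrite /e'; case: ifPn => hsi; first exact: he.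
  rewrite (@kd_deg i.+1) ?mulr0 ?subr0 // => u hu; exact: hc.
have [|s ss|b hb heb] := hi1 e'; first by move=> s hs; rewrite /e' ifN.
  apply: xreg; have := kd_ideal hI he' ss.
  by rewrite kdB kd_kd kdZ sub0r => /(idealN hI); rewrite opprK.
have [|s ss|b' hb' hcb'] := hi (fun s => c s - x * b s).
- by move=> s hs; rewrite hc // hb ?mulr0 ?subr0.
- rewrite kdB kdZ.
  have -> : kd xs c s - x * kd xs b s
     = (kd xs c s - x * e' s) + x * (e' s - kd xs b s) by ring.
  by apply: hD; [apply: he'|apply: hM; apply: heb].
exists b' => // s ss; exists (b s).
have -> : c s - kd xs b' s - x * b s = c s - x * b s - kd xs b' s by ring.
exact: hcb'.
Qed.

End Step.

Fixpoint adjoins I ys := if ys is y :: ys' then adjoins (adjoin I y) ys' else I.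

Fixpoint regulars I ys :=
  if ys is y :: ys' then regular_on I y /\ regulars (adjoin I y) ys' else True.

Lemma regulars_vanish xs I ys i : is_ideal I -> (forall y, List.In y ys -> in_span xs y) ->
  regulars I ys -> (i < size ys)%N -> koszul_vanish xs I i.
Proof.
elim: ys I i => // y ys IH I [|i] hI hm [hy hys] /= hi.
  by apply: (@koszul_vanish0 _ _ y) => //; apply: hm; left.
apply: (@koszul_vanishS _ _ y) => //; first by apply: hm; left.
apply: IH => //; first exact: adjoin_ideal.
by move=> z hz; apply: hm; right.
Qed.

(** Each adjoined element costs one degree of vanishing, by [koszul_vanish_adjoin]. *)
Lemma vanish_adjoins xs I ys e : is_ideal I -> (forall y, List.In y ys -> in_span xs y) ->
  regulars I ys -> (forall i, (i < size ys + e)%N -> koszul_vanish xs I i) ->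
  forall i, (i < e)%N -> koszul_vanish xs (adjoins I ys) i.
Proof.
elim: ys I => // y ys IH I hI hm [hy hys] /= hv; apply: IH => //.
- exact: adjoin_ideal.
- by move=> z hz; apply: hm; right.
move=> i hi; apply: koszul_vanish_adjoin => //; apply: hv.
  by rewrite addSn ltnS ltnW.
by rewrite addSn ltnS.
Qed.

Lemma adjoins_ideal I ys : is_ideal I -> is_ideal (adjoins I ys).
Proof. by elim: ys I => //= y ys IH I hI; apply/IH/adjoin_ideal. Qed.

Lemma regulars_size_le xs I ys zs u : is_ideal I ->
  (forall y, List.In y ys -> in_span xs y) -> regulars I ys ->
  (forall z, List.In z zs -> in_span xs z) -> regulars I zs ->
  ~ adjoins I ys u -> (forall x, x \in xs -> adjoins I ys (x * u)) ->
  (size zs <= size ys)%N.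
Proof.
move=> hI hym hy hzm hz hu hxu; rewrite leqNgt; apply/negP => hlt.
have hJ := adjoins_ideal ys hI.
have [h0 _ hM] := hJ.
have hv : koszul_vanish xs (adjoins I ys) 0.
  apply: (@vanish_adjoins xs I ys 1) => // i hi.
  by apply: regulars_vanish hzm hz _ => //; apply: leq_trans hi _; rewrite addn1.
(* Placed in degree 0, [u] is a cocycle by [kd_socle]; as there are no cochains in degree -1,
   vanishing would put [u] into the ideal. *)
case: (hv (fun s => if count id s == 0%N then u else 0)) => [s hs|s _|b hb hcb].
- by rewrite ifN.
- by apply: kd_socle => // x s' /hxu; case: ifP; rewrite ?mulr0.
apply: hu; have := hcb (nseq (size xs) false) (size_nseq _ _).
rewrite count_nseq mul0n eqxx (@kd_ext _ _ (fun=> 0)) ?kd0 ?subr0 // => s.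
exact: hb.
Qed.

End Koszul.

Lemma InP (T : eqType) (x : T) (s : seq T) : reflect (List.In x s) (x \in s).
Proof.
elim: s => [|y s IH] /=; first by constructor.
rewrite inE; apply: (iffP orP) => [[/eqP->|/IH]|[->|/IH]]; auto.
Qed.

(** * Depth in polynomial rings from a socle element *)

Section Depth.
Variables (k : fieldType) (n : nat).
Notation S := {mpoly k[n]}.
Implicit Types (I J G : S -> Prop) (p q u : S) (xs ys : seq S).

Lemma ideal_gen_ideal G : is_ideal (ideal_gen G).
Proof.
split.
- by exists [::]; rewrite big_nil.
- move=> a b [s [hs ->]] [s' [hs' ->]]; exists (s ++ s'); rewrite big_cat; split=> //.
  by move=> x /List.in_app_iff [/hs|/hs'].
- move=> r a [s [hs ->]]; exists [seq (r * x.1, x.2) | x <- s]; split.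
    by move=> x /List.in_map_iff [y [<- /hs]].
  by rewrite big_map mulr_sumr; apply: eq_bigr => x _ /=; rewrite mulrA.
Qed.

Lemma ideal_gen_sub G p : G p -> ideal_gen G p.
Proof.
move=> hp; exists [:: (1, p)]; rewrite big_seq1 /= mul1r; split=> // x [<-|] //.
Qed.

Lemma ideal_sum J (T : Type) (s : seq T) (F : T -> S) : is_ideal J ->
  (forall x, List.In x s -> J (F x)) -> J (\sum_(x <- s) F x).
Proof.
move=> [h0 hD hM]; elim: s => [|x s IH] h; first by rewrite big_nil.
by rewrite big_cons; apply: hD; [apply: h; left|apply: IH => y hy; apply: h; right].
Qed.

Lemma ideal_gen_min G J p : is_ideal J -> (forall q, G q -> J q) -> ideal_gen G p -> J p.
Proof.
move=> hJ hG [s [hs ->]]; apply: ideal_sum => // x /hs /hG.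
by case: hJ => _ _; apply.
Qed.

Lemma adjoin_sub I x p : I p -> adjoin I x p.
Proof. by exists 0; rewrite mulr0 subr0. Qed.

Lemma adjoins_sub I xs p : I p -> adjoins I xs p.
Proof. by elim: xs I => //= x xs IH I hp; apply/IH/adjoin_sub. Qed.

Lemma adjoins_mem I xs x : is_ideal I -> List.In x xs -> adjoins I xs x.
Proof.
elim: xs I => //= y xs IH I hI [->|hx]; last by apply: IH => //; apply: adjoin_ideal.
by apply: adjoins_sub; exists 1; rewrite mulr1 subrr; case: hI.
Qed.

Lemma ideal_add_seqE I xs p : is_ideal I -> ideal_add_seq I xs p <-> adjoins I xs p.
Proof.
move=> hI; split.
  apply: ideal_gen_min; first exact: adjoins_ideal.
  by move=> q [/adjoins_sub|/adjoins_mem] //; apply.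
elim: xs I hI p => [|x xs IH] I hI p /=; first by move=> hp; apply: ideal_gen_sub; left.
move=> /IH h; have {h} := h (adjoin_ideal x hI).
have hG := ideal_gen_ideal (fun p => I p \/ List.In p (x :: xs)).
apply: ideal_gen_min => // q [[e he]|hq]; last by apply: ideal_gen_sub; right; right.
apply: (ideal_sub hG (ideal_gen_sub (or_introl he))).
rewrite mulrC; case: hG => _ _; apply; apply: ideal_gen_sub; right; left; reflexivity.
Qed.

Lemma regularsE I xs : regulars I xs <-> forall i, (i < size xs)%N -> forall p,
  adjoins I (take i xs) (nth 0 xs i * p) -> adjoins I (take i xs) p.
Proof.
elim: xs I => [|x xs IH] I /=; first by split.
split=> [[hx /IH h] [|i]|h]; [exact: (fun=> hx)|exact: h|split].
  by have := h 0%N isT; rewrite take0.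
by apply/IH => i hi; apply: (h i.+1 hi).
Qed.

Lemma adjoins_span I xs p : is_ideal I -> adjoins I xs p ->
  exists2 gs, size gs = size xs & I (p - \sum_(gx <- zip gs xs) gx.1 * gx.2).
Proof.
elim: xs I => [|x xs IH] I hI /=; first by exists [::]; rewrite // big_nil subr0.
case/IH; first exact: adjoin_ideal.
move=> gs sg [e he]; exists (e :: gs); rewrite /= ?sg //.
by rewrite big_cons /= (mulrC e) opprD addrA addrAC.
Qed.

Definition variables : seq S := [seq 'X_i | i <- enum 'I_n].

Lemma in_max_ideal_span p : in_max_ideal p -> in_span variables p.
Proof.
move=> hp; have h0 : is_ideal (fun q : S => q = 0).
  by split=> // [a b -> ->|r a ->]; rewrite ?addr0 ?mulr0.
suff /(adjoins_span h0)[gs sg /eqP] : adjoins (fun q => q = 0) variables p.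
  by rewrite subr_eq0 => /eqP ->; exists gs.
have hI := adjoins_ideal variables h0; have [_ _ hM] := hI.
rewrite (mpolyE p); apply: ideal_sum => // m /InP hm.
have [i mi] : exists i, m i != 0%N.
  apply/existsP; rewrite -negb_forall; apply/negP => /forallP h.
  move: hm; rewrite mcoeff_msupp; have -> : m = 0%MM; last by rewrite hp eqxx.
  by apply/mnmP => i; rewrite mnm0E; apply/eqP.
have -> : m = (m - U_(i) + U_(i))%MM by rewrite submK // lep1mP.
rewrite mpolyXD scalerAl; apply: hM; apply: adjoins_mem => //.
by apply/InP/map_f; rewrite mem_enum.
Qed.

(* The socle element [u] shows that [xs] cannot be outgrown: a nonzero class in
   H^0 of the Koszul complex modulo [xs] lifts to a nonzero class of degree at
   most [size xs] modulo [I], whereas regular sequences kill low degrees. *)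
Lemma depth_eq_socle I xs u : is_ideal I ->
  (forall x, List.In x xs -> in_max_ideal x) ->
  (forall i, (i < size xs)%N -> forall p, ideal_add_seq I (take i xs) (nth 0 xs i * p) ->
     ideal_add_seq I (take i xs) p) ->
  ~ ideal_add_seq I xs u -> (forall i, ideal_add_seq I xs ('X_i * u)) ->
  depth_eq I (size xs).
Proof.
move=> hI hm hr hu hXu; split.
  exists xs; split=> //; split=> // h1; apply: hu.
  by rewrite -(mulr1 u); case: (ideal_gen_ideal (fun p => I p \/ List.In p xs)) => _ _; apply.
move=> ys [hym hyr _]; apply: (@regulars_size_le _ variables I xs ys u) => //.
- by move=> x /hm /in_max_ideal_span.
- by apply/regularsE => i hi p; rewrite -!ideal_add_seqE //; apply: hr.
- by move=> x /hym /in_max_ideal_span.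
- by apply/regularsE => i hi p; rewrite -!ideal_add_seqE //; apply: hyr.
- by rewrite -ideal_add_seqE.
by move=> x /mapP [i _ ->]; apply/ideal_add_seqE.
Qed.

End Depth.

(** * Monomial ideals and identification of variables *)

Section Monomial.
Variables (k : fieldType) (n : nat).
Notation S := {mpoly k[n]}.
Implicit Types (E : 'X_{1..n} -> Prop) (p q u : S) (m : 'X_{1..n}).

Definition mon E p := forall m, m \in msupp p -> E m.
Definition upclosed E := forall m m', E m -> E (m + m')%MM.

Lemma mon_ideal E : upclosed E -> is_ideal (mon E).
Proof.
move=> hE; split=> [m|p q hp hq m|r p hp m].
- by rewrite msupp0.
- by move=> /msuppD_le; rewrite mem_cat => /orP[/hp|/hq].
- by move=> /msuppM_le /allpairsP[[m1 m2] /= [_ /hp h ->]]; rewrite addmC; apply: hE.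
Qed.

Lemma monX E m : mon E 'X_[m] <-> E m.
Proof.
split=> [h|h m']; first by apply: h; rewrite msuppX mem_head.
by rewrite msuppX mem_seq1 => /eqP->.
Qed.

Lemma mon_gen E (J : S -> Prop) p : is_ideal J -> (forall m, E m -> J 'X_[m]) ->
  mon E p -> J p.
Proof.
move=> hJ h hp; rewrite (mpolyE p); apply: ideal_sum => // m /InP /hp /h hm.
by rewrite -mul_mpolyC; case: hJ => _ _; apply.
Qed.

Definition mpow (ms : seq 'X_{1..n}) t m := exists l : seq 'X_{1..n},
  [/\ size l = t, {subset l <= ms} & (\big[mnm_add/0%MM]_(x <- l) x <= m)%MM].

Lemma mpow_upclosed ms t : upclosed (mpow ms t).
Proof.
by move=> m m' [l [sl hl le]]; exists l; split=> //; apply: lepm_trans le (lem_addr _ _).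
Qed.

Lemma ideal_powE ms t p : ideal_pow (@monomial_ideal k n ms) t p <-> mon (mpow ms t) p.
Proof.
have hmon s : is_ideal (mon (mpow ms s)) by apply/mon_ideal/mpow_upclosed.
split.
  apply: ideal_gen_min => // q [qs [<- hqs ->]] {p q t}.
  elim: qs hqs => [|q qs IH] hqs.
    rewrite big_nil -mpolyX0; apply/monX; exists [::]; rewrite big_nil; split=> //.
    by apply/mnm_lepP => i; rewrite mnm0E.
  rewrite big_cons => m /msuppM_le /allpairsP[[m1 m2] /= [hm1 hm2 ->]].
  have {IH hm2}[|l [sl hl le2]] := IH _ m2 hm2; first by move=> x hx; apply: hqs; right.
  have {hqs}/(_ m1 hm1) [g hg le1] : mon (fun m => exists2 g, g \in ms & (g <= m)%MM) q.
    have : monomial_ideal ms q by apply: hqs; left.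
    apply: ideal_gen_min; first apply: mon_ideal.
      by move=> a b [g hg le]; exists g => //; apply: lepm_trans le (lem_addr _ _).
    by move=> _ [g hg ->]; apply/monX; exists g => //; apply: lepm_refl.
  exists (g :: l); split; rewrite /= ?sl // ?big_cons; last first.
    by apply/mnm_lepP => i; rewrite !mnmDE leq_add //; apply/mnm_lepP.
  by move=> x; rewrite inE => /orP[/eqP->|/hl].
apply: mon_gen; first exact: ideal_gen_ideal.
move=> m [l [sl hl le]].
rewrite -(submK le) mpolyXD; case: (ideal_gen_ideal (fun p => exists qs : seq S,
    [/\ size qs = t, (forall q, List.In q qs -> monomial_ideal ms q)
      & p = \prod_(q <- qs) q])) => _ _; apply.
apply: ideal_gen_sub; exists [seq 'X_[x] | x <- l]; split.
- by rewrite size_map.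
- move=> q /InP /mapP[x /hl hx ->]; apply: ideal_gen_sub; by exists x.
- by rewrite big_map -mpolyX_prod.
Qed.

(* If [X_i m] is not in the ideal then [p] has the same coefficient at [m] and at
   [m X_i / X_j], which allows an induction on the exponent of [X_j]. *)
Lemma mon_regular E (i j : 'I_n) p : i != j -> upclosed E ->
  (forall m, E (m + U_(i))%MM -> E m) -> mon E (('X_i - 'X_j) * p) -> mon E p.
Proof.
move=> ij hup hi h m; have [s] := ubnP (m j); elim: s m => // s IH m.
rewrite ltnS => hs hm; apply: hi.
have hc : (('X_i - 'X_j) * p)@_(m + U_(i)) = p@_m - ('X_j * p)@_(m + U_(i)).
  by rewrite mulrBl mcoeffB (mulrC 'X_i) addmC mcoeffMX.
(* If 'X_j does not divide [m], then 'X_j * p contributes nothing and the coefficient of [p] at [m]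
   survives. *)
have [hmj|hmj] := eqVneq (m j) 0%N.
  apply: h; rewrite mcoeff_msupp hc.
  have -> : ('X_j * p)@_(m + U_(i)) = 0.
    apply/eqP; rewrite mcoeff_eq0; apply/negP => /msuppM_le /allpairsP[[m1 m2] /= [h1 _ e]].
    move: h1; rewrite msuppX mem_seq1 => /eqP h1; move/mnmP/(_ j): e.
    by rewrite h1 !mnmDE !mnm1E (negPf ij) eqxx hmj.
  by rewrite subr0 -mcoeff_msupp.
pose m' := (m - U_(j) + U_(i))%MM.
have em' : (m + U_(i) = m' + U_(j))%MM.
  by rewrite /m' -addmA (addmC U_(i)%MM) addmA submK // lep1mP.
have [e|hne] := eqVneq p@_m p@_m'.
  rewrite em'; apply: hup; apply: IH; last by rewrite mcoeff_msupp -e -mcoeff_msupp.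
  rewrite /m' mnmDE mnmBE !mnm1E (negPf ij) eqxx addn0.
  by apply: leq_trans hs; rewrite subn1 prednK // lt0n.
by apply: h; rewrite mcoeff_msupp hc em' (mulrC 'X_j) addmC mcoeffMX subr_eq0.
Qed.

Section Substitution.
Variable tau : 'I_n -> 'I_n.
Hypothesis tauK : forall i, tau (tau i) = tau i.

Definition msubst p := p \mPo [tuple 'X_(tau i) | i < n].
Definition nsubst m : 'X_{1..n} := [multinom (\sum_(i < n | tau i == j) m i)%N | j < n].

Lemma nsubstD m m' : nsubst (m + m') = (nsubst m + nsubst m')%MM.
Proof.
apply/mnmP => j; rewrite mnmDE !mnmE -big_split /=.
by apply: eq_bigr => i _; rewrite mnmDE.
Qed.

Lemma nsubstK m : nsubst (nsubst m) = nsubst m.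
Proof.
apply/mnmP => j; rewrite !mnmE.
under eq_bigr => i _ do rewrite mnmE.
rewrite (exchange_big_dep (fun i => tau i == j)) /=; last first.
  by move=> i l /eqP <- /eqP <-; rewrite tauK.
apply: eq_bigr => l /eqP hl; rewrite (big_pred1 (tau l)) // => i /=.
by rewrite (eq_sym (tau l)); case: (i =P tau l) => [->|_]; rewrite ?andbF // tauK hl eqxx.
Qed.

Lemma msubstX m : msubst 'X_[m] = 'X_[nsubst m].
Proof.
rewrite /msubst comp_mpolyX [RHS]mpolyXE_id.
under [RHS]eq_bigr => j _ do rewrite mnmE -prodrXr.
rewrite (exchange_big_dep xpredT) //=; apply: eq_bigr => i _.
by rewrite (big_pred1 (tau i)) ?tnth_mktuple // => j; rewrite eq_sym.
Qed.

(** The property is stable under sums and products, so constants and variables suffice. *)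
Lemma msubst_diff (J : S -> Prop) p : is_ideal J ->
  (forall i, J ('X_i - 'X_(tau i))) -> J (p - msubst p).
Proof.
move=> hJ h; have [h0 hD hM] := hJ.
have hMM a b : J (a - msubst a) -> J (b - msubst b) -> J (a * b - msubst (a * b)).
  move=> ha hb; rewrite /msubst rmorphM -/(msubst a) -/(msubst b).
  have -> : a * b - msubst a * msubst b
     = b * (a - msubst a) + msubst a * (b - msubst b) by ring.
  by apply: hD; apply: hM.
have hC c : J (c%:MP - msubst c%:MP) by rewrite /msubst comp_mpolyC subrr.
rewrite (mpolyE p) /msubst rmorph_sum -sumrB /=; apply: ideal_sum => // m _.
rewrite -/(msubst _) -mul_mpolyC; apply: (hMM) => //.
rewrite mpolyXE_id; apply: (big_ind (fun a => J (a - msubst a))) => [|a b|].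
- by rewrite -mpolyC1; apply: hC.
- exact: hMM.
move=> i _; elim: {m}(m i) => [|e IH]; first by rewrite expr0 -mpolyC1; apply: hC.
rewrite exprS; apply: (hMM) => //.
rewrite /msubst comp_mpolyXU -tnth_nth tnth_mktuple; exact: h.
Qed.

(** For upward closed [E], these are the exponents of the monomials in the ideal of [E] plus all
    differences 'X_i - 'X_(tau i). *)
Definition esubst E m := exists2 m0, E m0 & nsubst m0 = nsubst m.

Lemma esubst_upclosed E : upclosed E -> upclosed (esubst E).
Proof.
move=> hE m m' [m0 h0 e]; exists (m0 + m')%MM; first exact: hE.
by rewrite !nsubstD e.
Qed.

Lemma esubst_nsubst E m : esubst E (nsubst m) <-> esubst E m.
Proof. by split=> -[m0 h0 e]; exists m0; rewrite // ?nsubstK in e *. Qed.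

(* Dividing out the differences ['X_i - 'X_(tau i)] from a monomial ideal
   leaves a monomial ideal in the remaining variables. *)
Lemma ideal_add_seq_subst E (I : S -> Prop) xs p : upclosed E ->
  (forall p, I p <-> mon E p) ->
  (forall x, List.In x xs -> msubst x = 0) ->
  (forall i, ideal_add_seq I xs ('X_i - 'X_(tau i))) ->
  ideal_add_seq I xs p <-> mon (esubst E) (msubst p).
Proof.
move=> hE hI hxs htau; have hmon := mon_ideal (esubst_upclosed hE).
have hJ := ideal_gen_ideal (fun p => I p \/ List.In p xs).
split.
  apply: (@ideal_gen_min _ _ _ (fun q => mon (esubst E) (msubst q))).
    have [h0 hD hM] := hmon; split=> [|a b|r a]; rewrite /msubst ?rmorph0 ?rmorphD ?rmorphM //.
      exact: hD.
    exact: hM.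
  move=> q [/hI hq|/hxs ->]; last by case: hmon.
  rewrite (mpolyE q) /msubst rmorph_sum; apply: ideal_sum => // m /InP /hq hm.
  rewrite -mul_mpolyC rmorphM /=; case: hmon => _ _; apply.
  by rewrite -/(msubst _) msubstX; apply/monX; exists m; rewrite ?nsubstK.
move=> hp; apply: (ideal_sub hJ (msubst_diff p hJ htau)).
apply: mon_gen hp => // m [m0 h0 e].
apply: (ideal_sub hJ (msubst_diff _ hJ htau)).
(* 'X_[m] and 'X_[m0] have the same image under [msubst], so the question moves to 'X_[m0], which
   lies in [I]. *)
rewrite msubstX -e -msubstX -(subrK 'X_[m0] (msubst _)) -opprB.
case: (hJ) => _ hD _; apply: hD; first by apply: idealN => //; apply: msubst_diff.
by apply: ideal_gen_sub; left; apply/hI/monX.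
Qed.

End Substitution.
End Monomial.

(** * Exponents in the powers of one block *)

Section Blocks.
Local Open Scope nat_scope.

(* A block [(d, delta)] encodes the product [I * K] of the ideals
     I = (w^(d+2), w^(d+1) v, w v^(d+1), v^(d+2), w^2 v^d y, w^2 v^d y'),
     K = (w^(d+1), w y^(d-1) y', y^d y') if delta, and (w, w, y y') otherwise;
   [bgen] is the type of pairs of a generator of [I] and a generator of [K].
   Exponents of [w], shared by all blocks, are kept apart ([iw], [kw], [gw]);
   those of [v], [y] and [y'] ([ie], [ke], [ge]) are indexed by [None],
   [Some false] and [Some true]. *)
Definition block := (nat * bool)%type.
Definition bgen := (((bool * bool) + bool) * option bool)%type.
Implicit Types (b : block) (t a : nat) (q : option bool -> nat) (r : option bool).

(** [inl (x, z)] is a product of one of w^(d+1), v^(d+1) and one of w, v, where [true] selects v;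
    [inr] gives the generators with y or y'. *)
Definition iw d (g : (bool * bool) + bool) : nat :=
  match g with inl (x, z) => ~~ x * d.+1 + ~~ z | inr _ => 2 end.
Definition ie d (g : (bool * bool) + bool) r : nat :=
  match r, g with
  | None, inl (x, z) => x * d.+1 + z
  | None, inr _ => d
  | Some _, inl _ => 0
  | Some e, inr e' => e == e'
  end.
Definition kw b (h : option bool) : nat :=
  match h with None => if b.2 then b.1.+1 else 1 | Some false => 1 | Some true => 0 end.
Definition ke b (h : option bool) r : nat :=
  match r, h with
  | Some e, Some true => if b.2 && ~~ e then b.1 else 1
  | Some e, Some false => if b.2 then (if e then 1 else b.1.-1) else 0
  | _, _ => 0
  end.

Definition gw b g := iw b.1 g.1 + kw b g.2.
Definition ge b g r := ie b.1 g.1 r + ke b g.2 r.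

(** The powers t to whose depth the block contributes 1, through y - y'. *)
Definition active b t := if b.2 then t == b.1 else b.1 <= t.

(* The monomial with exponents [a] and [q] lies in the t-th power of the block. *)
Definition bpow b t a q := exists h : nat -> bgen,
  \sum_(s < t) gw b (h s) <= a /\ forall r, \sum_(s < t) ge b (h s) r <= q r.

(* Membership in the image of the t-th power under y' := y. *)
Definition bpow_merged b t a q := exists2 q0, bpow b t a q0
  & q0 None = q None /\ q0 (Some false) + q0 (Some true) = q (Some false) + q (Some true).

Definition incr q r0 : option bool -> nat := fun r => q r + (r0 == r).

Lemma bpow_mono b t a a' q q' : a <= a' -> (forall r, q r <= q' r) ->
  bpow b t a q -> bpow b t a' q'.
Proof.
move=> ha hq [h [hw he]]; exists h; split; first exact: leq_trans hw ha.
by move=> r; apply: leq_trans (he r) (hq r).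
Qed.

Lemma sum_ltn t n : \sum_(s < t) (s < n) = minn t n.
Proof. by elim: t => [|t IH]; rewrite ?big_ord0 ?big_ord_recr /= ?IH; lia. Qed.

Lemma sum_first t (T : Type) (x z : T) (F : T -> nat) :
  \sum_(s < t.+1) F (if s == 0 :> nat then x else z) = F x + t * F z.
Proof. by rewrite big_ord_recl /= sum_nat_const card_ord. Qed.

Lemma sum_counts (h : nat -> option bool) t : exists n0 n1 n2, n0 + n1 + n2 = t /\
  forall F : option bool -> nat,
    \sum_(s < t) F (h s) = n0 * F None + n1 * F (Some false) + n2 * F (Some true).
Proof.
elim: t => [|t [n0 [n1 [n2 [<- hF]]]]].
  by exists 0, 0, 0; split=> // F; rewrite big_ord0.
case e: (h (n0 + n1 + n2)) => [[]|].
- exists n0, n1, n2.+1; split=> [|F]; first by rewrite addnS.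
  by rewrite big_ord_recr hF /= e; lia.
- exists n0, n1.+1, n2; split=> [|F]; first by rewrite addnS.
  by rewrite big_ord_recr hF /= e; lia.
- exists n0.+1, n1, n2; split=> [|F]; first by rewrite addSn.
  by rewrite big_ord_recr hF /= e; lia.
Qed.

Lemma counts_sum n0 n1 n2 : exists h : nat -> option bool, forall F : option bool -> nat,
  \sum_(s < n0 + n1 + n2) F (h s) = n0 * F None + n1 * F (Some false) + n2 * F (Some true).
Proof.
exists (fun s => if s < n0 then None else Some (n0 + n1 <= s)) => F.
rewrite 2!big_split_ord /=; congr (_ + _ + _).
- by under eq_bigr => i _ do rewrite ltn_ord; rewrite sum_nat_const card_ord.
- rewrite (eq_bigr (fun=> F (Some false))) ?sum_nat_const ?card_ord // => i _.
  by rewrite ltnNge leq_addr /= leqNgt ltn_add2l ltn_ord.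
- rewrite (eq_bigr (fun=> F (Some true))) ?sum_nat_const ?card_ord // => i _.
  by rewrite ltnNge -addnA leq_addr /= addnA leq_addr.
Qed.

(* For [t >= b.1] the first factor of a block is the power [(w, v)^((d+2)t)]. *)
Lemma bpow_late b t a q : b.1 <= t -> bpow b t a q <-> exists n0 n1 n2,
  let K (F : option bool -> nat) := n0 * F None + n1 * F (Some false) + n2 * F (Some true) in
  [/\ n0 + n1 + n2 = t, K (kw b) <= a, b.1.+2 * t + K (kw b) <= a + q None
    & forall e, K (fun h => ke b h (Some e)) <= q (Some e)].
Proof.
move=> bt; split.
  move=> [h [hw he]]; have [n0 [n1 [n2 [hn hF]]]] := sum_counts (fun s => (h s).2) t.
  exists n0, n1, n2 => K; rewrite /K; split=> //; rewrite -?hF.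
  - by apply: leq_trans hw; apply: leq_sum => s _; rewrite /gw leq_addl.
  (* Every generator of [I] has degree d + 2 in w and v together. *)
  - apply: leq_trans (leq_add hw (he None)).
    rewrite -big_split /= -[t in b.1.+2 * t]card_ord mulnC -sum_nat_const -big_split /=.
    apply: leq_sum => s _; rewrite /gw /ge /=.
    by case: (h s) => [[[[] []]|[]] o] /=; lia.
  - move=> e; rewrite -(hF (fun h => ke b h (Some e))).
    by apply: leq_trans (he (Some e)); apply: leq_sum => s _; rewrite /ge leq_addl.
case=> n0 [n1 [n2 [hn]]].
have [hK hF] := counts_sum n0 n1 n2; rewrite hn in hF.
rewrite -(hF (kw b)) => hwa hwv he.
(* [B] is the exponent of v to be used, written as (d+1)m + r: [m] factors take v^(d+1) and [r]
   factors take v. If m = t then r <= t since B <= (d+2)t; otherwise r is a remainder, at most d <=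
   t. *)
pose B := minn (q None) (b.1.+2 * t); pose m := minn t (B %/ b.1.+1).
pose r := B - b.1.+1 * m.
have hm : b.1.+1 * m <= B.
  by apply: leq_trans (leq_trunc_div B b.1.+1); rewrite mulnC leq_mul2r geq_minr orbT.
have hr : r <= t.
  rewrite /r /m; case: (leqP t (B %/ b.1.+1)) => h.
    by rewrite leq_subLR -mulSnr geq_minr.
  have := divn_eq B b.1.+1; have := ltn_pmod B (ltn0Sn b.1).
  by rewrite ltnS mulnC => h1 e; rewrite leq_subLR {1}e leq_add2l (leq_trans h1).
exists (fun s => (inl (s < m, s < r), hK s)); split.
  rewrite /gw big_split /= big_split /=.
  have e1 : \sum_(s < t) ~~ (s < m) * b.1.+1 + b.1.+1 * m = b.1.+1 * t.
    have -> : b.1.+1 * m = \sum_(s < t) (s < m) * b.1.+1.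
      by rewrite -big_distrl /= sum_ltn mulnC; congr (_ * _); rewrite /m; lia.
    rewrite -big_split /= (eq_bigr (fun=> b.1.+1)) ?sum_nat_const ?card_ord 1?mulnC // => s _.
    by case: (s < m); lia.
  have e2 : \sum_(s < t) ~~ (s < r) + r = t.
    have {2}-> : r = \sum_(s < t) (s < r) by rewrite sum_ltn; lia.
    rewrite -big_split /= (eq_bigr (fun=> 1)) ?sum_nat_const ?card_ord ?muln1 // => s _.
    by case: (s < r).
  have er : b.1.+1 * m + r = B by rewrite subnKC.
  have hB : b.1.+2 * t + \sum_(s < t) kw b (hK s) <= a + B.
    by rewrite /B; case: (leqP (q None) (b.1.+2 * t)) => _ //; rewrite addnC leq_add2r.
  move: e1 e2 hB er.
  move: (\sum_(s < t) ~~ (s < m) * b.1.+1) (\sum_(s < t) ~~ (s < r)) => s1 s2.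
  move: (\sum_(s < t) kw b (hK s)) => s3; clearbody B m r.
  clear; move: (b.1.+1 * m) => x; rewrite !mulSn; lia.
case=> [e|].
  rewrite /ge /=; under eq_bigr => s _ do rewrite add0n.
  by rewrite (hF (fun h => ke b h (Some e))).
rewrite /ge /= big_split /= big_split /= -big_distrl /= !sum_ltn.
rewrite (hF (fun h => ke b h None)) /=; rewrite /B in hm *; rewrite /r; lia.
Qed.

Definition bpow_active (m : bool) b t a q := if m then bpow_merged b t a q else bpow b t a q.

Definition mono_except r0 (P : nat -> (option bool -> nat) -> Prop) :=
  forall a a' q q', a <= a' -> (forall r, r != r0 -> q r <= q' r) -> P a q -> P a' q'.

(** If [b.2] is false this reflects (w, y y')^t = (w, y)^t ∩ (w, y')^t, otherwise the decomposition
    of K^d; in both cases [P0] and [P1] carry the factor (w, v)^((d+2)t). *)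
Lemma bpow_split b t : active b t -> exists P0 P1,
  [/\ mono_except (Some false) P0, mono_except (Some true) P1
    & forall a q, bpow b t a q <-> P0 a q /\ P1 a q].
Proof.
case: b => d [] /= ht; last first.
- exists (fun a q => d.+2 * t <= a + q None /\
                     t <= minn a (a + q None - d.+2 * t) + q (Some true)).
  exists (fun a q => d.+2 * t <= a + q None /\
                     t <= minn a (a + q None - d.+2 * t) + q (Some false)).
  split.
  + move=> a a' q q' ha hq; have := hq None isT; have := hq (Some true) isT.
    by move=> {hq} /=; move: (d.+2 * t) => x; lia.
  + move=> a a' q q' ha hq; have := hq None isT; have := hq (Some false) isT.
    by move=> {hq} /=; move: (d.+2 * t) => x; lia.
  move=> a q; rewrite bpow_late //=; move: (d.+2 * t) => x; split.
    move=> [n0 [n1 [n2 [hn hw hv he]]]]; have := he true; have := he false; rewrite /=; lia.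
  move=> [[h1 h2] [h3 h4]].
  (* [m0] is the number of factors w of [K], as large as the exponents of w and v allow. *)
  have hm : exists2 m0, m0 <= t & [/\ m0 <= a, x + m0 <= a + q None,
      t - m0 <= q (Some false) & t - m0 <= q (Some true)].
    by exists (minn t (minn a (a + q None - x))); [lia|split; lia].
  case: hm => m0 h0 [h5 h6 h7 h8].
  by exists m0, 0, (t - m0); split; rewrite /= ?muln0 ?muln1 ?addn0 ?subnKC // => -[]; lia.
move/eqP: ht => ->.
pose P (a : nat) (q : option bool -> nat) (c : nat) :=
  c <= a /\ d.+2 * d + c <= a + q None.
exists (fun a q => P a q (d.+1 * (d - q (Some true)))).
exists (fun a q => exists n0 n1 n2, [/\ n0 + n1 + n2 = d, P a q (n0 * d.+1 + n1) &
   n1 * d.-1 + n2 * d <= q (Some false)]).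
split.
- move=> a a' q q' ha hq; have := hq None isT; have := hq (Some true) isT; rewrite /P.
  move: (d.+2 * d) => x h1 h2.
  have : d.+1 * (d - q' (Some true)) <= d.+1 * (d - q (Some true)) by rewrite leq_mul2l leq_sub2l ?orbT.
  by move: (d.+1 * _) (d.+1 * _) => y z; lia.
- move=> a a' q q' ha hq; have := hq None isT; have := hq (Some false) isT; rewrite /P.
  move: (d.+2 * d) => x h1 h2 [n0 [n1 [n2 [h3 [h4 h5] h6]]]].
  exists n0, n1, n2; split=> //; last exact: leq_trans h6 h1.
  by split; [exact: leq_trans h4 ha|apply: leq_trans h5 _; apply: leq_add].
move=> a q; rewrite bpow_late //=; split.
  move=> [n0 [n1 [n2 /= [hn hw hv he]]]]; have := he true; have := he false.
  rewrite /= !muln0 !muln1 !addn0 !add0n in hw hv *; move=> h1 h2.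
  split; last by exists n0, n1, n2.
  have : d.+1 * (d - q (Some true)) <= n0 * d.+1 by rewrite mulnC leq_mul2r; lia.
  by rewrite /P; move: (d.+1 * (_ - _)) (n0 * d.+1) (d.+2 * d) hw hv => x y z; lia.
move=> [[p1 p2] [n0 [n1 [n2 [hn [p3 p4] p5]]]]].
case: (leqP (d - q (Some true)) n0) => h.
  exists n0, n1, n2; split=> //=; rewrite ?muln0 ?muln1 ?addn0 //.
  by case; rewrite /= ?muln0 ?muln1 ?add0n //; lia.
(* With j = q (Some true) < d, here n1 + n2 >= j + 1, and (j+1)(d-1) >= j d: so y suffices for j
   copies of y^d y', and [P0] pays for the other d - j factors w^(d+1). *)
exists (d - q (Some true)), 0, (q (Some true)); split=> /=.
- by rewrite addn0 subnK //; lia.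
- by rewrite muln0 mul0n !addn0 mulnC.
- by rewrite muln0 mul0n !addn0 (mulnC (_ - _)).
case; rewrite /= ?muln0 ?muln1 ?mul0n ?addn0 ?add0n //.
apply: leq_trans p5; move: (q (Some true)) h => j h.
by case: d hn h {p1 p2 p3 p4 P} => [|d] hn h; rewrite ?muln0 //=; nia.
Qed.

(** With T = t.+1, the socle element is w^((d+2)T) y^(e-1). All of w serves (w, v)^((d+2)T), so [K]
    could only use T copies of its last generator, of degree e after y' := y. One more w or v pays
    for a generator of [K] with a single w, which lowers the degree needed to e - 1 or less. *)
Lemma bpow_socle_active b t : 0 < b.1 -> b.1 <= t.+1 -> exists A q,
  [/\ ~ bpow_merged b t.+1 A q, bpow_merged b t.+1 A.+1 q
    & forall r, bpow_merged b t.+1 A (incr q r)].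
Proof.
move=> hd hbt; pose ky := ke b (Some true) (Some false).
pose e := (ky + 1) * t.+1.
have he : e.-1.+1 = e by rewrite prednK // /e muln_gt0 addn1.
have hmem c a q i j n0 n1 n2 : n0 + n1 + n2 = t.+1 -> n0 * kw b None + n1 <= c -> c <= 1 ->
    b.1.+2 * t.+1 + c <= a + q None -> b.1.+2 * t.+1 <= a ->
    n1 * ke b (Some false) (Some false) + n2 * ky <= i ->
    n1 * ke b (Some false) (Some true) + n2 <= j ->
    i + j = q (Some false) + q (Some true) -> bpow_merged b t.+1 a q.
  move=> hn hw hc hv ha hi hj hij.
  exists (fun r => if r is Some e then (if e then j else i) else q None) => //.
  apply/bpow_late => //; exists n0, n1, n2; split=> //=.
  - by rewrite muln0 addn0 muln1; apply: leq_trans hw _; apply: leq_trans hc (leq_trans _ ha).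
  - by rewrite muln0 addn0 muln1; apply: leq_trans hv; rewrite leq_add2l.
  - case; rewrite muln0 add0n; first by apply: leq_trans hj; rewrite /= andbF muln1.
    exact: hi.
have hone a q : b.1.+2 * t.+1 + 1 <= a + q None -> b.1.+2 * t.+1 <= a ->
    e.-1 = q (Some false) + q (Some true) -> bpow_merged b t.+1 a q.
  move=> hv ha hq; case eb: b.2.
    apply: (hmem 1 a q (b.1.-1 + t * b.1) t.+1 0 1 t) => //; rewrite ?mul1n ?add1n //.
    - by rewrite /ky /ke eb.
    - by rewrite /= eb.
    - by rewrite -hq /e /ky /ke eb /=; nia.
  apply: (hmem 1 a q t.+1 t 1 0 t) => //; rewrite ?mul0n ?add0n ?mul1n ?addn0 /kw ?eb //.
  - by rewrite /ky /ke eb muln1.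
  - by rewrite -hq /e /ky /ke eb /=; lia.
have hzero a q : b.1.+2 * t.+1 <= a -> e = q (Some false) + q (Some true) ->
    bpow_merged b t.+1 a q.
  move=> ha hq; apply: (hmem 0 a q (t.+1 * ky) t.+1 0 0 t.+1) => //.
  - by rewrite addn0; apply: leq_trans ha (leq_addr _ _).
  - by rewrite -hq /e mulnDl mul1n mulnC.
exists (b.1.+2 * t.+1), (fun r => if r == Some false then e.-1 else 0); split.
- move=> [q0 /(bpow_late _ _ hbt) [n0 [n1 [n2 [hn _ hv hq]]]] [hq0 hs]].
  move: hs hv (hq false) (hq true).
  rewrite hq0 /= !muln0 !muln1 !addn0 !add0n => hs hv h2 h3.
  have [h0 h1] : n0 = 0 /\ n1 = 0.
    by move: hv; move: (b.1.+2 * t.+1) => x; case: (b.2); nia.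
  move: hn h2 h3; rewrite h0 h1 !mul0n !add0n => -> h2; rewrite andbF muln1 => h3.
  have : e <= e.-1 by rewrite -hs /e mulnDl mul1n mulnC leq_add.
  by rewrite -he ltnn.
- by apply: hone; rewrite ?addn0 ?addn1.
case=> [s|].
  by apply: hzero => //; rewrite /incr /=; case: s => /=; lia.
by apply: hone; rewrite /incr ?addn0.
Qed.

(** With T = t.+1, the socle element is w^A v^d, where A + 1 = T (d + 1 + kw b None). Without y and
    y' and with at most v^d, each factor needs w to the power d + 1 + kw b None. One more w admits
    (w^(d+1) v)^T, one more v admits w v^(d+1) w^((d+2)t), and one more y admits w^2 v^d y
    w^((d+2)t), likewise for y'; the exponents fit because T < d. *)
Lemma bpow_socle_early b t : t.+1 < b.1 -> exists A q,
  [/\ ~ bpow b t.+1 A q, bpow b t.+1 A.+1 q & forall r, bpow b t.+1 A (incr q r)].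
Proof.
move=> hd; pose w := b.1.+1 + kw b None.
exists (w * t.+1).-1, (fun r => if r is None then b.1 else 0).
have hw : (w * t.+1).-1.+1 = w * t.+1 by rewrite prednK // muln_gt0.
have hmem g0 g1 a q : iw b.1 g0 + t * iw b.1 g1 + t.+1 * kw b None <= a ->
    (forall r, ie b.1 g0 r + t * ie b.1 g1 r <= q r) -> bpow b t.+1 a q.
  move=> ha hq; exists (fun s => (if s == 0 then g0 else g1, None)).
  rewrite /gw /ge; split=> [|r] /=; rewrite big_split /= sum_nat_const card_ord.
    by rewrite (sum_first _ _ _ (iw b.1)).
  by rewrite (sum_first _ _ _ (fun g => ie b.1 g r)); case: r (hq r) => [?|]; rewrite muln0 addn0.
split.
- move=> [h [ha hq]].
  have hge (s : 'I_t.+1) r : ge b (h s) r <= (if r is None then b.1 else 0).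
    by apply: leq_trans (hq r); rewrite (bigD1 s) //= leq_addr.
  have : w * t.+1 <= \sum_(s < t.+1) gw b (h s).
    rewrite -[X in w * X]card_ord mulnC -sum_nat_const; apply: leq_sum => s _.
    have := hge s None; have := hge s (Some false); have := hge s (Some true).
    rewrite /w /ge /gw /ke /kw.
    by case: (h s) => [[[[] []]|[]] [[]|]] /=; case: (b.2) => /=; lia.
  by rewrite -hw ltnNge ha.
- apply: (hmem (inl (false, true)) (inl (false, true))).
    by rewrite hw /w [iw _ _]/=; move: (kw b None) => p; nia.
  by case=> [s|] /=; rewrite ?muln0 //; lia.
case=> [s|].
- apply: (hmem (inr s) (inl (false, false))).
    by rewrite -ltnS hw /w ![iw _ _]/=; move: (kw b None) => p; nia.
  by case=> [s'|]; rewrite /incr /= ?muln0 ?addn0 ?add0n // eq_sym.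
- apply: (hmem (inl (true, false)) (inl (false, false))).
    by rewrite -ltnS hw /w ![iw _ _]/=; move: (kw b None) => p; nia.
  by case=> [s'|]; rewrite /incr /= ?mul0n ?mul1n ?muln0 ?addn0 ?add0n ?muln0 //; lia.
Qed.

(** The socle element is w^((d+2)t + (d+1)(t-d)) y^(d^2-1) y'^d. The exponent of y' forces t - d
    factors w^(d+1), which exhaust w, and d copies of y^d y' need one more y. One more w or v turns
    one copy into w y^(d-1) y'; one more y' allows trading one w^(d+1) and the d copies for d + 1
    copies of w y^(d-1) y', as (d+1)(d-1) = d^2-1. *)
Lemma bpow_socle_late d t : 0 < d -> d < t -> exists A q,
  [/\ ~ bpow (d, true) t A q, bpow (d, true) t A.+1 q
    & forall r, bpow (d, true) t A (incr q r)].
Proof.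
case: d => // d _ hd; have hdt : d.+1 <= t by exact: ltnW.
(* The block parameter is now [d.+1], and [m.+1] is its distance to [t]. *)
have [m ht] : exists m, t = d.+2 + m by exists (t - d.+2); rewrite subnKC.
have hx : 0 < d.+3 * t by rewrite muln_gt0; lia.
exists (d.+3 * t + d.+2 * m.+1),
  (fun r => if r is Some e then (if e then d.+1 else d.+1 * d.+1 - 1) else 0).
have hone a q : d.+3 * t + d.+2 * m.+1 + 1 <= a + q None -> d.+3 * t + d.+2 * m.+1 <= a ->
    d.+1 * d.+1 - 1 <= q (Some false) -> d.+1 <= q (Some true) -> bpow (d.+1, true) t a q.
  move=> h1 h2 h3 h4; apply/bpow_late => //.
  exists m.+1, 1, d; split=> //=; rewrite ?muln0 ?muln1 ?addn0.
  - lia.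
  - lia.
  - lia.
  - by case; rewrite /= ?muln1 ?mul1n; lia.
split.
- move=> /(@bpow_late (d.+1, true) _ _ _ hdt) [n0 [n1 [n2 [/= hn _ hv hq]]]].
  move: hv (hq false) (hq true); rewrite /= !muln0 !muln1 !addn0 !add0n leq_add2l => hv hq0 hq1.
  have hm : n0 = m.+1.
    have : n0 <= m.+1 by rewrite -(@leq_pmul2l d.+2) // mulnC; lia.
    lia.
  have hn1 : n1 = 0 by move: hv; rewrite hm mulnC; lia.
  have hn2 : n2 = d.+1 by lia.
  by move: hq0; rewrite hn1 hn2; lia.
- by apply: hone; lia.
case=> [[]|].
- apply/bpow_late => //; exists m, d.+2, 0; split; rewrite /incr /= ?muln0 ?muln1 ?addn0; try lia.
  by case; rewrite /= ?muln0 ?muln1 ?addn0 ?add0n; lia.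
- apply/bpow_late => //; exists m.+1, 0, d.+1; split; rewrite /incr /= ?muln0 ?muln1 ?addn0; try lia.
  by case; rewrite /= ?muln0 ?muln1 ?addn0 ?add0n; lia.
- by apply: hone; rewrite /incr /=; lia.
Qed.

Lemma bpow_socle b t : 0 < b.1 -> 0 < t -> exists A q,
  [/\ ~ bpow_active (active b t) b t A q, bpow_active (active b t) b t A.+1 q
    & forall r, bpow_active (active b t) b t A (incr q r)].
Proof.
case: t => // t hd _; case: (boolP (active b t.+1)) => hact /=.
  by apply: bpow_socle_active => //; move: hact; rewrite /active; case: b.2 => // /eqP ->.
case: b hd hact => d [] /= hd; rewrite /active /= => hact.
  have [|] := ltnP d t.+1; first exact: bpow_socle_late.
  by rewrite leq_eqVlt (negPf hact) => /(@bpow_socle_early (d, true)).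
by rewrite -ltnNge in hact; apply: bpow_socle_early.
Qed.

End Blocks.

(** * Products of blocks sharing the variable w *)

Section Assembly.
Variables (k : fieldType) (N : nat) (B : 'I_N -> block).
Notation index := (option ('I_N * option bool)).
Notation n := #|{: index}|.
Notation S := {mpoly k[n]}.
Implicit Types (m : 'X_{1..n}) (x : index) (p : S) (U : seq 'I_N) (j : 'I_N).

Definition var x : 'I_n := enum_rank x.
Definition part m j : option bool -> nat := fun r => m (var (Some (j, r))).

Lemma mnm_var m m' : (forall x, m (var x) = m' (var x)) -> m = m'.
Proof. by move=> h; apply/mnmP => i; rewrite -(enum_valK i). Qed.

Definition mnm_of (F : index -> nat) : 'X_{1..n} := [multinom F (enum_val i) | i < n].

Lemma mnm_ofE F x : mnm_of F (var x) = F x.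
Proof. by rewrite mnmE enum_rankK. Qed.

Lemma mnm1_var x x' : (U_(var x))%MM (var x') = (x == x').
Proof. by rewrite mnm1E (inj_eq enum_rank_inj). Qed.

(* The additional factor [w] keeps the product proper if there are no blocks. *)
Definition gexp (phi : {ffun 'I_N -> bgen}) x : nat :=
  match x with
  | None => 1 + \sum_j gw (B j) (phi j)
  | Some (j, r) => ge (B j) (phi j) r
  end%N.

Definition gens : seq 'X_{1..n} := [seq mnm_of (gexp phi) | phi : {ffun 'I_N -> bgen}].

(** [a] distributes the exponent of w over the blocks; the summand [t] pays for the extra factor w
    of each of the t generators. *)
Definition epow (P : 'I_N -> nat -> (option bool -> nat) -> Prop) t m : Prop :=
  exists a : 'I_N -> nat, (t + \sum_j a j <= m (var None))%N /\
    forall j, P j (a j) (part m j).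

Lemma subset_map (T T' : eqType) (f : T -> T') (s : seq T) (l : seq T') :
  {subset l <= map f s} -> exists l', l = map f l'.
Proof.
elim: l => [|x l IH] hl; first by exists [::].
have [|l' ->] := IH; first by move=> z hz; apply: hl; rewrite inE hz orbT.
have /mapP[z _ ->] := hl x (mem_head _ _).
by exists (z :: l').
Qed.

Lemma mpow_gens t m : mpow gens t m <-> epow (fun j => bpow (B j) t) t m.
Proof.
split.
  case=> l [sl /subset_map[ls el] /mnm_lepP hle].
  have sls : size ls = t by rewrite -sl el size_map.
  have hF (F : {ffun 'I_N -> bgen} -> nat) :
      (\sum_(phi <- ls) F phi = \sum_(s < t) F (nth [ffun=> (inr true, None)] ls s))%N.
    by rewrite (big_nth [ffun=> (inr true, None)]) big_mkord sls.
  have hx x : (\sum_(s < t) gexp (nth [ffun=> (inr true, None)] ls s) x <= m (var x))%N.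
    rewrite -(hF (fun phi => gexp phi x)); apply: leq_trans (hle (var x)).
    by rewrite el big_map mnm_sumE; under [leqRHS]eq_bigr => phi _ do rewrite mnm_ofE.
  exists (fun j => \sum_(s < t) gw (B j) (nth [ffun=> (inr true, None)] ls s j))%N; split.
    apply: leq_trans (hx None); rewrite exchange_big /= big_split /=.
    by rewrite sum_nat_const card_ord muln1.
  move=> j; exists (fun s => nth [ffun=> (inr true, None)] ls s j); split=> // r.
  exact: (hx (Some (j, r))).
case=> a [ha /fin_all_exists[h hh]].
pose phi s := [ffun j => h j s].
exists (mkseq (fun s => mnm_of (gexp (phi s))) t); split.
- by rewrite size_mkseq.
- by move=> _ /mapP[s _ ->]; apply/mapP; exists (phi s); rewrite ?mem_enum.
apply/mnm_lepP => i; rewrite -(enum_valK i) -/(var _); move: (enum_val i) => {i} x.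
rewrite big_map mnm_sumE -{1}(subn0 t) -/(index_iota 0 t) big_mkord.
under eq_bigr => s _ do rewrite mnm_ofE.
case: x => [[j r]|] /=.
  by under eq_bigr => s _ do rewrite ffunE; have [_ /(_ r)] := hh j.
apply: leq_trans ha; rewrite big_split /= sum_nat_const card_ord muln1 leq_add2l.
rewrite exchange_big /=; apply: leq_sum => j _; have [hw _] := hh j.
by under eq_bigr => s _ do rewrite ffunE.
Qed.

Definition monotone (P : nat -> (option bool -> nat) -> Prop) :=
  forall a a' q q', (a <= a')%N -> (forall r, q r <= q' r)%N -> P a q -> P a' q'.

Lemma epow_upclosed P t : (forall j, monotone (P j)) -> upclosed (epow P t).
Proof.
move=> hP m m' [a [ha h]]; exists a; split; first by rewrite mnmDE (leq_trans ha) ?leq_addr.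
by move=> j; apply: hP (h j) => // r; rewrite /part mnmDE leq_addr.
Qed.

Section Fold.
Variable U : seq 'I_N.

Definition fold_index x : index :=
  if x is Some (j, Some true) then (if j \in U then Some (j, Some false) else x) else x.
Definition fold_var (i : 'I_n) : 'I_n := var (fold_index (enum_val i)).

Lemma fold_var_var x : fold_var (var x) = var (fold_index x).
Proof. by rewrite /fold_var enum_rankK. Qed.

Lemma fold_varK i : fold_var (fold_var i) = fold_var i.
Proof.
rewrite /fold_var enum_rankK; case: (enum_val i) => [[j [[]|]]|] //=.
by case: ifP => //= ->.
Qed.

Lemma nsubst_var m x : nsubst fold_var m (var x)
  = (\sum_(x' | fold_index x' == x) m (var x'))%N.
Proof.
rewrite mnmE (reindex var) /=; last first.
  by apply: onW_bij; exists enum_val; [apply: enum_rankK|apply: enum_valK].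
by apply: eq_bigl => x'; rewrite fold_var_var (inj_eq enum_rank_inj).
Qed.

Lemma nsubst_fold m m' : nsubst fold_var m = nsubst fold_var m' <->
  m (var None) = m' (var None) /\ forall j,
  if j \in U then part m j None = part m' j None /\
    (part m j (Some false) + part m j (Some true)
     = part m' j (Some false) + part m' j (Some true))%N
  else part m j =1 part m' j.
Proof.
have hpair (m0 : 'X_{1..n}) j : j \in U -> nsubst fold_var m0 (var (Some (j, Some false)))
    = (part m0 j (Some false) + part m0 j (Some true))%N.
  move=> hj; rewrite nsubst_var (bigD1 (Some (j, Some false))) //= (bigD1 (Some (j, Some true))) /=.
    rewrite big1 ?addn0 // => -[[j' [[]|]]|] /=; rewrite ?andbF //.
    - by case: ifP => _ /andP[/andP[/eqP[]]] // ->; rewrite eqxx.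
    - by move=> /andP[/andP[-> ]].
    - by move=> /andP[/andP[/eqP]].
  by rewrite hj eqxx /=; apply/eqP => -[].
have hone (m0 : 'X_{1..n}) x :
    (if x is Some (j, Some _) then j \notin U else true) ->
    nsubst fold_var m0 (var x) = m0 (var x).
  move=> hx; rewrite nsubst_var (big_pred1 x) // => -[[j' [[]|]]|] //=.
  case: ifP => // hj'; case: x hx => [[j [[]|]]|] //= hj; apply/eqP/eqP => //.
  - by case=> e; rewrite -e hj' in hj.
  - by case=> e; rewrite -e hj' in hj.
split=> [e|[e0 e]].
  split; first by rewrite -(hone m None) // -(hone m' None) // e.
  move=> j; case: ifPn => hj; last first.
    by case=> [r|]; rewrite /part -[LHS]hone // -[RHS]hone // e.
  by rewrite -!hpair // e; split=> //; rewrite /part -[LHS]hone // -[RHS]hone // e.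
apply: mnm_var => -[[j r]|]; last by rewrite !hone.
have := e j; case: ifPn => hj ej; last first.
  have hr : is_true (if r is Some _ then j \notin U else true) by case: (r).
  by rewrite (hone m (Some (j, r)) hr) (hone m' (Some (j, r)) hr); apply: ej.
case: ej => ev es; case: r => [[]|].
- have hz x' : (fold_index x' == Some (j, Some true)) = false.
    apply/eqP; case: x' => [[j' [[]|]]|] //=; case: ifPn => // hj' [e'].
    by rewrite e' hj in hj'.
  by rewrite !nsubst_var !big_pred0.
- by rewrite !hpair.
- by rewrite (hone m (Some (j, None))) // (hone m' (Some (j, None))).
Qed.

(** Folding fixes w and acts inside each block, so a distribution of w carries over unchanged. *)
Lemma esubst_gens t m : esubst fold_var (mpow gens t) m <->
  epow (fun j => bpow_active (j \in U) (B j) t) t m.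
Proof.
split.
  case=> m0 /mpow_gens[a [ha h]] /nsubst_fold[e0 e]; exists a; split; first by rewrite -e0.
  move=> j; have := e j; have := h j; case: (j \in U) => /= hj ej; first by exists (part m0 j).
  by apply: bpow_mono hj => // r; rewrite ej.
case=> a [ha h].
have /fin_all_exists[q hq] : forall j, exists q0, bpow (B j) t (a j) q0 /\
    if j \in U then q0 None = part m j None /\
      (q0 (Some false) + q0 (Some true) = part m j (Some false) + part m j (Some true))%N
    else q0 =1 part m j.
  move=> j; have := h j; case: (j \in U) => /=; first by case=> q0 h1 h2; exists q0.
  by move=> hj; exists (part m j).
pose m0 := mnm_of (fun x => if x is Some (j, r) then q j r else m (var None)).
have hm0 j : part m0 j =1 q j by move=> r; rewrite /part mnm_ofE.
exists m0.
  apply/mpow_gens; exists a; split; first by rewrite mnm_ofE.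
  by move=> j; have [hj _] := hq j; apply: bpow_mono hj => // r; rewrite hm0.
apply/nsubst_fold; split; first by rewrite mnm_ofE.
move=> j; have [_] := hq j; case: (j \in U) => [[h1 h2]|hj]; first by rewrite !hm0.
by move=> r; rewrite hm0.
Qed.

End Fold.

Lemma bpow_active_mono c b t : monotone (bpow_active c b t).
Proof.
case: c => /= a a' q q' ha hq; last exact: bpow_mono.
case=> q0 h0 [hv hs].
(* The exponent of y' in [q0] is kept, and the whole increase goes to y. *)
exists (fun r => match r with
  | None => q' None
  | Some true => q0 (Some true)
  | Some false => q' (Some false) + q' (Some true) - q0 (Some true) end)%N => /=.
  apply: bpow_mono h0 => // r; have h1 := hq (Some false); have h2 := hq (Some true).
  by case: r => [[]|] //=; [lia|rewrite hv].
by split=> //; have h1 := hq (Some false); have h2 := hq (Some true); lia.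
Qed.

Definition upd (P : 'I_N -> nat -> (option bool -> nat) -> Prop) j0 R j :=
  if j == j0 then R else P j.

(** Given two distributions of w, take their maximum at [j0] and their minimum elsewhere: the total
    is at most that of the distribution that is larger at [j0]. *)
Lemma epow_split P j0 P0 P1 t m : (forall a q, P j0 a q <-> P0 a q /\ P1 a q) ->
  monotone P0 -> monotone P1 ->
  epow P t m <-> epow (upd P j0 P0) t m /\ epow (upd P j0 P1) t m.
Proof.
move=> h01 h0 h1; rewrite /upd; split.
  by case=> a [ha h]; split; exists a; split=> // j; case: eqP => [->|_] //;
    have /h01[] := h j0.
case=> -[a [ha h]] [a' [ha' h']].
exists (fun j => if j == j0 then maxn (a j) (a' j) else minn (a j) (a' j)); split.
  have [le|lt] := leqP (a j0) (a' j0).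
    apply: leq_trans ha'; rewrite leq_add2l; apply: leq_sum => j _.
    by case: eqP => [->|_]; rewrite ?geq_minr // geq_max le leqnn.
  apply: leq_trans ha; rewrite leq_add2l; apply: leq_sum => j _.
  by case: eqP => [->|_]; rewrite ?geq_minl // geq_max leqnn ltnW.
move=> j; move: (h j) (h' j); case: eqP => [->|_] hj hj'.
  by apply/h01; split; [apply: h0 hj|apply: h1 hj'] => //; rewrite ?leq_maxl ?leq_maxr.
by rewrite /minn; case: ifP.
Qed.

Definition diff j : S := 'X_(var (Some (j, Some false))) - 'X_(var (Some (j, Some true))).

Lemma msubst_var U x :
  msubst (fold_var U) 'X_(var x) = 'X_(var (fold_index U x)) :> S.
Proof. by rewrite /msubst comp_mpolyXU -tnth_nth tnth_mktuple fold_var_var. Qed.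

Lemma msubst_diff0 U j : j \in U -> msubst (fold_var U) (diff j) = 0.
Proof. by move=> hj; rewrite /diff /msubst rmorphB /= -!/(msubst _ _) !msubst_var /= hj subrr. Qed.

Lemma msubst_diffM U j p : j \notin U ->
  msubst (fold_var U) (diff j * p) = diff j * msubst (fold_var U) p.
Proof.
move=> hj; rewrite /diff /msubst rmorphM rmorphB /= -!/(msubst _ _) !msubst_var /=.
by rewrite (negPf hj).
Qed.

Definition fold_epow U t := epow (fun j => bpow_active (j \in U) (B j) t) t.

Lemma ideal_add_diff U t p :
  ideal_add_seq (ideal_pow (@monomial_ideal k n gens) t) [seq diff j | j <- U] p
  <-> mon (fold_epow U t) (msubst (fold_var U) p).
Proof.
have hE m : esubst (fold_var U) (mpow gens t) m <-> fold_epow U t m by exact: esubst_gens.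
rewrite (@ideal_add_seq_subst _ _ (fold_var U) (fold_varK U) (mpow gens t)).
- by split=> h m /h /hE.
- exact: mpow_upclosed.
- by move=> q; apply: ideal_powE.
- by move=> _ /InP /mapP[j hj ->]; apply: msubst_diff0.
move=> i; have hJ := ideal_gen_ideal (fun q : S => ideal_pow (@monomial_ideal k n gens) t q \/
  List.In q [seq diff j | j <- U]).
rewrite -(enum_valK i) -/(var _) fold_var_var; case: (enum_val i) => [[j [[]|]]|] /=;
  rewrite ?subrr; try by case: hJ.
case: ifPn => hj; last by rewrite subrr; case: hJ.
rewrite -opprB; apply: idealN => //; apply: ideal_gen_sub; right.
by apply/InP/map_f.
Qed.

(** The ideal is an intersection by [bpow_split] and [epow_split]; one component does not involve
    y_j, the other does not involve y'_j, and [mon_regular] applies to each, with the sign of the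
    difference reversed for the second. *)
Lemma diff_regular U j t p : j \notin U -> active (B j) t ->
  mon (fold_epow U t) (diff j * p) -> mon (fold_epow U t) p.
Proof.
move=> hj /bpow_split[P0 [P1 [h0 h1 h01]]].
pose P j' := bpow_active (j' \in U) (B j') t.
have hm0 : monotone P0 by move=> a a' q q' ha hq; apply: h0.
have hm1 : monotone P1 by move=> a a' q q' ha hq; apply: h1.
have hP j' : monotone (P j') by exact: bpow_active_mono.
have hsplit m : fold_epow U t m <-> epow (upd P j P0) t m /\ epow (upd P j P1) t m.
  by apply: epow_split => // a q; rewrite /P (negPf hj).
have hup R : monotone R -> upclosed (epow (upd P j R) t).
  by move=> hR; apply: epow_upclosed => j'; rewrite /upd; case: eqP.
have hfree e R : mono_except (Some e) R -> forall m,
    epow (upd P j R) t (m + U_(var (Some (j, Some e))))%MM -> epow (upd P j R) t m.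
  move=> hR m [a [ha h]]; exists a; split.
    by move: ha; rewrite mnmDE mnm1_var addn0.
  move=> j'; have := h j'; rewrite /upd; case: eqP => [->|hne].
    apply: hR => // r hr; rewrite /part mnmDE mnm1_var.
    by case: eqP => [[er]|_]; [rewrite er eqxx in hr|rewrite addn0].
  apply: hP => // r; rewrite /part mnmDE mnm1_var.
  by case: eqP => [[/esym]|_] //; rewrite addn0.
have hneq e e' : e != e' -> var (Some (j, Some e)) != var (Some (j, Some e')).
  by move=> he; rewrite (inj_eq enum_rank_inj); apply/eqP => -[ee]; rewrite ee eqxx in he.
move=> h m hm; apply/hsplit; split; move: m hm.
  apply: (@mon_regular _ _ _ (var (Some (j, Some false))) (var (Some (j, Some true)))).
  - exact: hneq.
  - exact: hup.
  - exact: hfree.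
  by move=> m /h /hsplit[].
apply: (@mon_regular _ _ _ (var (Some (j, Some true))) (var (Some (j, Some false)))).
- exact: hneq.
- exact: hup.
- exact: hfree.
have hI : is_ideal (mon (k := k) (epow (upd P j P1) t)) by apply/mon_ideal/hup.
by rewrite -opprB mulNr; apply: (idealN hI) => m /h /hsplit[].
Qed.

(** The exponent of w is one short of t + \sum_j (A j + 1), while block [j] rejects the share A j.
    One more w fills the gap; any other variable lets its block manage with A j. *)
Lemma fold_epow_socle t U : (0 < t)%N -> (forall j, 0 < (B j).1)%N ->
  (forall j, (j \in U) = active (B j) t) ->
  exists m, ~ fold_epow U t m /\ forall x, fold_epow U t (U_(var x) + m)%MM.
Proof.
move=> ht hB hU.
have /fin_all_exists[A hA] : forall j, exists A, exists q,
  [/\ ~ bpow_active (j \in U) (B j) t A q, bpow_active (j \in U) (B j) t A.+1 q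
    & forall r, bpow_active (j \in U) (B j) t A (incr q r)].
  by move=> j; rewrite hU; apply: bpow_socle.
have {hA}/fin_all_exists[q hq] := hA.
pose m := mnm_of (fun x => if x is Some (j, r) then q j r else t.-1 + \sum_j (A j).+1)%N.
have hm j r : part m j r = q j r by rewrite /part mnm_ofE.
have hw : m (var None) = (t.-1 + \sum_j (A j).+1)%N by rewrite mnm_ofE.
exists m; split.
  case=> a [ha h]; have hlt j : (A j < a j)%N.
    rewrite ltnNge; apply/negP => hle; have [hn _ _] := hq j; apply: hn.
    by apply: bpow_active_mono (h j) => // r; rewrite hm.
  have : (\sum_j (A j).+1 <= \sum_j a j)%N by apply: leq_sum => j _; apply: hlt.
  by move: ha; rewrite hw; lia.
case=> [[j r]|]; last first.
  exists (fun j => (A j).+1); split; first by rewrite mnmDE mnm1_var eqxx hw; lia.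
  move=> j; have [_ h _] := hq j; apply: bpow_active_mono h => // r.
  by rewrite /part mnmDE -/(part m j r) hm leq_addl.
exists (fun j' => if j' == j then A j else (A j').+1); split.
  rewrite mnmDE mnm1_var hw add0n (bigD1 j) //= eqxx [X in (_ <= _ + X)%N](bigD1 j) //=.
  by rewrite (eq_bigr (fun i => (A i).+1)) => [|i /negPf -> //]; rewrite addSn addnS -addSn prednK.
move=> j'; have [_ h1 h2] := hq j'; case: eqP => [e|_].
  move: h1 h2; rewrite e => _ /(_ r); apply: bpow_active_mono => // r'.
  rewrite /part mnmDE mnm1_var -/(part m j r') hm /incr addnC leq_add2r.
  by case: eqP => [->|] //; rewrite eqxx.
by apply: bpow_active_mono h1 => // r'; rewrite /part mnmDE -/(part m j' r') hm leq_addl.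
Qed.

Lemma depth_power_gens t : (0 < t)%N -> (forall j, 0 < (B j).1)%N ->
  depth_eq (ideal_pow (@monomial_ideal k n gens) t) (count (fun b => active b t) (codom B)).
Proof.
move=> ht hB; pose U := [seq j <- enum 'I_N | active (B j) t].
have hU j : (j \in U) = active (B j) t by rewrite mem_filter mem_enum andbT.
have -> : count (fun b => active b t) (codom B) = size [seq diff j | j <- U].
  by rewrite size_map size_filter codomE count_map.
have [m [hm hxm]] := fold_epow_socle ht hB hU.
have hX m' : ideal_add_seq (ideal_pow (@monomial_ideal k n gens) t) [seq diff j | j <- U] 'X_[m']
    <-> fold_epow U t m'.
  rewrite ideal_add_diff msubstX monX.
  rewrite /fold_epow -!esubst_gens; apply: esubst_nsubst; exact: fold_varK.
apply: (@depth_eq_socle _ _ _ _ 'X_[m]).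
- exact: ideal_gen_ideal.
- move=> _ /InP /mapP[j _ ->]; rewrite /in_max_ideal /diff mcoeffB !mcoeffX.
  by rewrite !mnm1_eq0 subrr.
- move=> i; rewrite size_map => hi p; rewrite -map_take.
  have [j0 _] : exists j0 : 'I_N, true by case: (U) hi => // j0 *; exists j0.
  rewrite (nth_map j0) //.
  (* [U] has no repetitions, so y and y' of the current block are not yet identified. *)
  have hnotin : nth j0 U i \notin take i U.
    have hu : uniq U by rewrite filter_uniq ?enum_uniq.
    rewrite -(cat_take_drop i U) cat_uniq in hu; case/and3P: hu => _ /hasPn h _.
    by apply: h; rewrite (drop_nth j0) ?mem_head.
  rewrite !ideal_add_diff msubst_diffM //; apply: diff_regular => //.
  by rewrite -hU mem_nth.
- by rewrite hX.
by move=> i; rewrite -mpolyXD hX -(enum_valK i).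
Qed.

End Assembly.

Theorem theorem4p1 (k : fieldType) (f : nat -> nat)
  (hf : exists t0 : nat, (1 <= t0)%N /\ forall t : nat, (t0 <= t)%N -> f t = f t0) :
  exists (n : nat) (ms : seq 'X_{1..n}),
    forall t : nat, (1 <= t)%N ->
      depth_eq (ideal_pow (@monomial_ideal k n ms) t) (f t).
Proof.
case: hf => t0 [ht0 hf].
(* [(s, true)] is active at t = s only, [(t0, false)] at every t >= t0. *)
pose bs : seq block := flatten [seq nseq (f s) (s, true) | s <- index_iota 1 t0]
  ++ nseq (f t0) (t0, false).
pose B (j : 'I_(size bs)) := tnth (in_tuple bs) j.
exists #|{: option ('I_(size bs) * option bool)}|, (gens B) => t ht.
have hcod : codom B = bs by rewrite codomE map_tnth_enum.
have hbs : all (fun b : block => 0 < b.1)%N bs.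
  rewrite all_cat all_nseq ht0 orbT andbT; apply/allP => b /flattenP[s /mapP[s' hs' ->]].
  by rewrite mem_index_iota in hs'; case/andP: hs' => hs' _ /nseqP[->].
have -> : f t = count (fun b => active b t) (codom B).
  rewrite hcod count_cat count_flatten -map_comp count_nseq /active /=.
  rewrite (eq_map (g := fun s => (t == s) * f s)%N) => [|s]; last by rewrite /= count_nseq.
  rewrite sumnE big_map; case: leqP => htt0.
    rewrite mul1n big1_seq ?add0n ?hf // => s /andP[_]; rewrite mem_index_iota => /andP[_ hs].
    by rewrite gtn_eqF // (leq_trans hs).
  rewrite mul0n addn0 (bigD1_seq t) ?iota_uniq ?mem_index_iota ?ht //= eqxx mul1n.
  by rewrite big1 ?addn0 // => s; rewrite eq_sym => /negPf ->.
apply: depth_power_gens => // j; move/allP: hbs; apply; exact: mem_tnth.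
Qed.
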